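(* Let $p$ be a prime, let $n\geq 2$, and let the group $G$ be isomorphic to any of the groups $\mathrm{UT}_n(\mathbb F_p)$, $\mathrm{UT}_n^\ell(\mathbb F_p)$ or $\Gamma_{n,\ell}=\mathrm{UT}_n(\mathbb F_p)/\gamma_\ell(\mathrm{UT}_n(\mathbb F_p))$, where $1\leq \ell\leq n-2$. Then the Bogomolov multiplier of $G$ is trivial: $B_0(G)=0$.
   Context: For a finite group $G$, the Bogomolov multiplier of $G$ is $$B_0(G)=\bigcap_{A}\ker\{\mathrm{res}_G^A:H^2(G,\mathbb Q/\mathbb Z)\to H^2(A,\mathbb Q/\mathbb Z)\},$$ where $\mathbb Q/\mathbb Z$ has trivial $G$-action, $\mathrm{res}$ is the restriction map in group cohomology, and $A$ runs over all bicyclic subgroups of $G$ (a group is bicyclic if it is cyclic or a direct product of two cyclic groups). $\mathrm{UT}_n(\mathbb F_p)$ is the group of all $n\times n$ upper unitriangular matrices (upper triangular with all diagonal entries equal to $1$) with entries in the field $\mathbb F_p$ of $p$ elements. For $\ell\ge 1$, $\mathrm{UT}_n^\ell(\mathbb F_p)$ is the subgroup of all matrices in $\mathrm{UT}_n(\mathbb F_p)$ whose first $\ell-1$ diagonals above the main diagonal are zero (i.e. the $(i,j)$ entry is $0$ whenever $0<j-i<\ell$); in particular $\mathrm{UT}_n^1(\mathbb F_p)=\mathrm{UT}_n(\mathbb F_p)$. The lower central series of a group $H$ is defined by $\gamma_1(H)=H$ and $\gamma_{\ell+1}(H)=[\gamma_\ell(H),H]$. The condition $1\le\ell\le n-2$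 applies only to the two families indexed by $\ell$; the group $\mathrm{UT}_n(\mathbb F_p)$ is allowed for every $n\ge2$. *)

(* Defs.v *)
From HB Require Import structures.
From mathcomp Require Import all_boot all_order all_algebra all_fingroup all_solvable.
From mathcomp Require Import boolp classical_sets.
From mathcomp Require Import archimedean ring_quotient.

Set Implicit Arguments.
Unset Strict Implicit.
Unset Printing Implicit Defensive.

Import GRing.Theory.
Local Open Scope ring_scope.
Local Open Scope quotient_scope.

(* H^2(G, M) for a trivial G-module M, via inhomogeneous cochains. *)
Section SecondCohomology.
Variables (gT : finGroupType) (M : zmodType).

Definition is_cocycle2 : {pred {ffun gT * gT -> M}} := fun f =>
  [forall x, forall y, forall z,
     f (y, z) - f (x * y, z)%g + f (x, y * z)%g - f (x, y) == 0].

Lemma is_cocycle2P (f : {ffun gT * gT -> M}) :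
  reflect (forall x y z,
      f (y, z) - f (x * y, z)%g + f (x, y * z)%g - f (x, y) = 0)
    (f \in is_cocycle2).
Proof.
apply: (iffP forallP) => [H x y z | H x].
  by have /forallP/(_ y)/forallP/(_ z)/eqP := H x.
by apply/forallP=> y; apply/forallP=> z; apply/eqP.
Qed.

Lemma is_cocycle2_zmod_closed : zmod_closed is_cocycle2.
Proof.
split=> [|f g /is_cocycle2P Hf /is_cocycle2P Hg]; apply/is_cocycle2P=> x y z.
  by rewrite !ffunE subr0 addr0 subr0.
have := congr2 (fun u v => u - v) (Hf x y z) (Hg x y z).
rewrite !ffunE subrr => <-; rewrite !opprD !opprK.
by rewrite [LHS](AC (2*2*2*2) ((1*3*5*7)*(2*4*6*8))).
Qed.

HB.instance Definition _ :=
  GRing.isZmodClosed.Build _ is_cocycle2 is_cocycle2_zmod_closed.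

Record cocycle2 := Cocycle2 {
  cocycle2_val :> {ffun gT * gT -> M};
  cocycle2_valP : cocycle2_val \in is_cocycle2 }.

HB.instance Definition _ := [isSub for cocycle2_val].
HB.instance Definition _ := [Choice of cocycle2 by <:].
HB.instance Definition _ := [SubChoice_isSubZmodule of cocycle2 by <:].

Definition is_coboundary2 : {pred cocycle2} := fun f =>
  `[< exists h : gT -> M, forall x y, f (x, y) = h y - h (x * y)%g + h x >].

Lemma is_coboundary2_zmod_closed : zmod_closed is_coboundary2.
Proof.
split=> [|f g /asboolP[h Hh] /asboolP[k Hk]]; apply/asboolP.
  by exists (fun=> 0) => x y; rewrite subrr addr0 /= ffunE.
exists (fun x => h x - k x) => x y.
rewrite /= !ffunE -/(f (x, y)) -/(g (x, y)) Hh Hk !opprD !opprK.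
by rewrite [LHS](AC (3*3) ((1*4)*(2*5)*(3*6))).
Qed.

HB.instance Definition _ :=
  GRing.isZmodClosed.Build _ is_coboundary2 is_coboundary2_zmod_closed.

Definition H2 := {ideal_quot is_coboundary2}.

End SecondCohomology.

Arguments is_cocycle2 {gT M}.
Arguments is_coboundary2 {gT M}.

Lemma H2_pi_eq0 (gT : finGroupType) (M : zmodType) (f : cocycle2 gT M) :
  (\pi_(H2 gT M) f == 0) = (f \in is_coboundary2).
Proof.
rewrite -[f in RHS]subr0 Quotient.idealrBE.
by rewrite -[0 in LHS](raddf0 (\pi_(H2 gT M))).
Qed.

Section Restriction.
Variables (gT : finGroupType) (M : zmodType) (A : {group gT}).

Definition res_cochain2 (f : {ffun gT * gT -> M}) :
    {ffun subg_of A * subg_of A -> M} :=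
  [ffun u => f (sgval u.1, sgval u.2)].

Lemma res_cochain2_cocycle (f : cocycle2 gT M) :
  res_cochain2 f \in is_cocycle2.
Proof.
apply/is_cocycle2P=> x y z; rewrite !ffunE /=.
exact: (is_cocycle2P _ (cocycle2_valP f)).
Qed.

Definition res_cocycle2 (f : cocycle2 gT M) : cocycle2 (subg_of A) M :=
  Cocycle2 (res_cochain2_cocycle f).

(* Defined on representatives; [res2_pi] shows independence of the choice. *)
Definition res2 (c : H2 gT M) : H2 (subg_of A) M :=
  \pi_(H2 (subg_of A) M) (res_cocycle2 (generic_quotient.repr c)).

Lemma res2_pi (f : cocycle2 gT M) :
  res2 (\pi_(H2 gT M) f) = \pi_(H2 (subg_of A) M) (res_cocycle2 f).
Proof.
apply/eqP; rewrite -Quotient.idealrBE; apply/asboolP.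
have /asboolP[h Hh] : generic_quotient.repr (\pi_(H2 gT M) f) - f \in is_coboundary2.
  by rewrite Quotient.idealrBE reprK.
exists (fun x => h (sgval x)) => x y.
by have := Hh (sgval x) (sgval y); rewrite /= !ffunE.
Qed.

End Restriction.

Definition int_in_rat : {pred rat} := fun x => x \is a Num.int.

Lemma int_in_rat_zmod_closed : zmod_closed int_in_rat.
Proof. by split=> [|x y Hx Hy]; [exact: rpred0 | exact: rpredB]. Qed.

HB.instance Definition _ :=
  GRing.isZmodClosed.Build _ int_in_rat int_in_rat_zmod_closed.

Definition QZ := {ideal_quot int_in_rat}.

Definition bicyclic (gT : finGroupType) (A : {group gT}) : Prop :=
  cyclic A \/
  exists B C : {group gT}, [/\ cyclic B, cyclic C & (B \x C)%g = A].

Definition bogomolov_multiplier (gT : finGroupType) : set (H2 gT QZ) :=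
  (\bigcap_(A in [set A : {group gT} | bicyclic A])
     [set c : H2 gT QZ | res2 A c = 0])%classic.
Arguments bogomolov_multiplier : clear implicits.

(* {'GL_n(p)} consists of matrices of size n.-1.+1, i.e. of size n for n > 0. *)
Section Unitriangular.
Variables (n p : nat).

Definition UT : {set {'GL_n(p)}} :=
  [set g : {'GL_n(p)} |
    [forall i : 'I_n.-1.+1, forall j : 'I_n.-1.+1, (j <= i)%N ==> (GLval g i j == (i == j)%:R)]]%SET.

(* The (i, j) entry vanishes for 0 < j - i < l (truncated subtraction). *)
Definition UTl (l : nat) : {set {'GL_n(p)}} :=
  [set g in UT |
    [forall i : 'I_n.-1.+1, forall j : 'I_n.-1.+1, (0 < j - i < l)%N ==> (GLval g i j == 0)]]%SET.

Lemma in_UTl l (g : {'GL_n(p)}) :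
  reflect (forall i j : 'I_n.-1.+1, (j <= i)%N || (j < i + l)%N ->
             GLval g i j = (i == j)%:R)
    (g \in UTl l).
Proof.
rewrite !inE; apply: (iffP andP) => [[/forallP H1 /forallP H2] i j|H].
  have [le_ji _|lt_ij /= lt_jl] := leqP j i.
    by have /forallP/(_ j)/implyP/(_ le_ji)/eqP := H1 i.
  have /forallP/(_ j)/implyP H3 := H2 i.
  have /H3/eqP -> : (0 < j - i < l)%N.
    by rewrite subn_gt0 lt_ij /= ltn_subLR // ltnW.
  by case: eqP lt_ij => // ->; rewrite ltnn.
split; apply/forallP=> i; apply/forallP=> j; apply/implyP.
  by move=> le_ji; rewrite H ?le_ji.
case/andP; rewrite subn_gt0 => lt_ij lt_l.
have /negPf neq_ij : i != j by apply: contraTneq lt_ij => ->; rewrite ltnn.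
rewrite H ?neq_ij //.
by rewrite -ltn_subLR ?lt_l ?orbT // ltnW.
Qed.

Lemma UTl_group_set l : group_set (UTl l).
Proof.
apply/group_setP; split=> [|g h /in_UTl Hg /in_UTl Hh]; apply/in_UTl=> i j Hij.
  by rewrite GL_1E mxE.
rewrite GL_MxE mxE (bigD1 i) //= Hg ?leqnn // eqxx mul1r Hh //.
rewrite big1 ?addr0 // => k neq_ki.
have [Hik|] := boolP ((k <= i)%N || (k < i + l)%N).
  by rewrite Hg // eq_sym (negPf neq_ki) mul0r.
rewrite negb_or -ltnNge -leqNgt => /andP[lt_ik le_k].
have lt_jk : (j < k)%N.
  by case/orP: Hij => [/leq_ltn_trans|/leq_trans]; apply.
rewrite Hh ?(ltnW lt_jk) //.
by case: eqP lt_jk => [->|_ _]; rewrite ?ltnn ?mulr0.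
Qed.

Canonical UTl_group l := Group (UTl_group_set l).

Lemma UTl1 : UTl 1 = UT.
Proof.
apply/setP=> g; rewrite inE; case: (g \in UT) => //=.
apply/forallP=> i; apply/forallP=> j.
by rewrite ltnS; case: (j - i)%N.
Qed.

Lemma UT_group_set : group_set UT.
Proof. by rewrite -UTl1 UTl_group_set. Qed.

Canonical UT_group := Group UT_group_set.

End Unitriangular.

(* Main.v *)
Require Import Defs.
From HB Require Import structures.
From mathcomp Require Import all_boot all_order all_algebra all_fingroup all_solvable.
From mathcomp Require Import boolp classical_sets.
From mathcomp Require Import zify.

(* A class c in B_0(G) gives a central extension E of G by Q/Z in which any two
   lifts of commuting elements of G commute; it has to be split.  In all three
   families G is generated by the images x_ij of the elementary matrices
   1 + e_ij with j - i >= l.  If j - i >= 2l, lift x_ij to the commutator of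
   lifts of x_ir and x_rj.  This does not depend on r: since x_ir x_ir' commutes
   with x_rj x_r'j^-1, so do their lifts.  If j - i < 2l, a lift of x_ij can be
   corrected to have order p, because Q/Z is divisible.  Commutators of lifts
   only depend on the elements lifted, so these lifts satisfy the Steinberg
   relations, and writing a unitriangular matrix as an ordered product of
   elementary ones column by column defines a splitting. *)

Set Implicit Arguments.
Unset Strict Implicit.
Unset Printing Implicit Defensive.

(** * Steinberg relations and their lift to a central extension *)

Section Steinberg.
Import GroupScope.
Local Open Scope nat_scope.
Local Open Scope group_scope.

(* [y i j] plays the role of the elementary matrix [1 + e_ij] (0-based indices
   below [N]); only the pairs with [i + l <= j] matter. *)
Definition steinberg (p l N : nat) (H : groupType) (y : nat -> nat -> H) :
    Prop :=
  [/\ forall i j, i + l <= j -> j < N -> y i j ^+ p = 1,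
      forall i j k m, i + l <= j -> k + l <= m -> j < N -> m < N ->
        j <> k -> i <> m -> commute (y i j) (y k m)
    & forall i j k, i + l <= j -> j + l <= k -> k < N ->
        y i j * y j k = y i k * (y j k * y i j)].

(** The twists of the two pairs enter with opposite exponents. If [c = c'] they cancel and the
    products commute; conversely, if the products commute then [c = c']. [steinberg_lift] uses the
    first in [G] and the second in [E]. *)
Lemma mul_twisted (H : groupType) (a b c a' b' c' : H) :
    a * b = c * (b * a) -> a' * b' = c' * (b' * a') ->
    commute a' b -> commute a b' ->
    commute c' a -> commute c' b -> commute c' b' ->
  (a * a') * (b * b'^-1) = c * c'^-1 * ((b * b'^-1) * (a * a')).
Proof.
move=> ab ab' ca'b cab' ca cb cb'.
have a'V : a' * b'^-1 = c'^-1 * (b'^-1 * a').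
  apply: (mulIg b'); apply: (mulgI b'); apply: (mulgI c').
  by rewrite mulgVK -ab' !mulgA cb' mulgK mulgV mul1g.
have cV x : commute c' x -> commute x c'^-1.
  by move=> h; apply: commuteV; apply: commute_sym.
rewrite -(mulgA a) (mulgA a') ca'b -(mulgA b) a'V !mulgA ab.
rewrite -!mulgA; congr (c * _); rewrite !mulgA.
rewrite -(mulgA b a) (cV _ ca) (mulgA b) (cV _ cb) -!mulgA.
by rewrite (mulgA a) (commuteV cab') -!mulgA.
Qed.

Section Lift.
Variables (p l N : nat) (G E : groupType) (pi : E -> G) (x : nat -> nat -> G).
Hypothesis l_gt0 : (0 < l)%N.
Hypothesis piM : {morph pi : u v / u * v}.
Hypothesis pi_surj : forall g, exists u, pi u = g.
Hypothesis commute_pi : forall u v, commute (pi u) (pi v) -> commute u v.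
Hypothesis ker_div : forall u, pi u = 1 -> exists2 w, pi w = 1 & w ^+ p = u.

(** [commute_pi] also makes the kernel of [pi] central, as 1 commutes with everything. The clause on
    [x i j = 1] lets the splitting descend to quotients in which some generators die. *)
Lemma steinberg_lift : steinberg p l N x ->
  exists2 y : nat -> nat -> E, steinberg p l N y &
    forall i j, (i + l <= j)%N -> (j < N)%N ->
      pi (y i j) = x i j /\ (x i j = 1 -> y i j = 1).
Proof.
case=> xp xC xM.
have pi1 : pi 1 = 1 by apply: (mulgI (pi 1)); rewrite -piM !mulg1.
have piV u : pi u^-1 = (pi u)^-1.
  by apply: (mulgI (pi u)); rewrite -piM !mulgV.
have piX u k : pi (u ^+ k) = pi u ^+ k.
  by elim: k => [|k IHk]; rewrite ?pi1 // !expgS piM IHk.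
have kerZ z u : pi z = 1 -> commute z u.
  by move=> z1; apply: commute_pi; rewrite z1; exact/commute_sym/commute1.
have [t tK] := choice pi_surj.
pose T i j := t (x i j).
have tC i j k m : (i + l <= j)%N -> (k + l <= m)%N -> (j < N)%N -> (m < N)%N ->
    j <> k -> i <> m -> commute (T i j) (T k m).
  by move=> *; apply: commute_pi; rewrite !tK; apply: xC.
pose c i r j := T i r * T r j * ((T r j * T i r)^-1).
have cE i r j : T i r * T r j = c i r j * (T r j * T i r) by rewrite /c mulgVK.
have pic i r j : (i + l <= r)%N -> (r + l <= j)%N -> (j < N)%N ->
    pi (c i r j) = x i j.
  move=> ir rj jN; rewrite /c !(piM, piV) !tK xM //.
  by rewrite mulgK.
have cC i r j k m : (i + l <= r)%N -> (r + l <= j)%N -> (k + l <= m)%N ->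
    (j < N)%N -> (m < N)%N -> j <> k -> i <> m -> commute (c i r j) (T k m).
  move=> *; apply: commute_pi; rewrite pic // tK; apply: xC => //; lia.
have c_indep i r r' j : (i + l <= r)%N -> (r + l <= j)%N ->
    (i + l <= r')%N -> (r' + l <= j)%N -> (j < N)%N -> c i r j = c i r' j.
  move=> ir rj ir' r'j jN; have [-> //|/eqP ne_r] := eqVneq r r'.
  have : commute (T i r * T i r') (T r j * (T r' j)^-1).
    apply: commute_pi; rewrite !(piM, piV) !tK.
    rewrite /commute (@mul_twisted _ _ _ (x i j) _ _ (x i j)) ?mulgV ?mul1g //;
      try (by apply: xM); apply: xC; lia.
  rewrite /commute (@mul_twisted _ _ _ (c i r j) _ _ (c i r' j)) //;
    try (by apply: cC; lia); try (by apply: tC; lia).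
  by move=> /(canRL (mulgK _)); rewrite mulgV => /divg1_eq.
have /choice[y yP] : forall ij : nat * nat, exists Y, (ij.1 + l <= ij.2)%N ->
    (ij.2 < N)%N ->
    [/\ pi Y = x ij.1 ij.2, Y ^+ p = 1, x ij.1 ij.2 = 1 -> Y = 1 &
      forall r, (ij.1 + l <= r)%N -> (r + l <= ij.2)%N -> c ij.1 r ij.2 = Y].
  case=> i j /=; have [lij|lij] := leqP (i + l + l)%N j.
    exists (c i (i + l)%N j) => ij jN.
    have cx : pi (c i (i + l)%N j) = x i j by apply: pic.
    (* [w] commutes with [u] and [v], so [u ^+ p * v = w ^+ p * (v * u ^+ p)]. But [u ^+ p] lies
       over 1, hence is central, which forces [w ^+ p = 1]. *)
    have cXp : c i (i + l)%N j ^+ p = 1.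
      set u := T i (i + l)%N; set v := T (i + l)%N j; set w := c _ _ _.
      have wu : commute w u by apply: cC; lia.
      have wv : commute w v by apply: cC; lia.
      have uv : u * v = w * (v * u) by exact: cE.
      have uXv k : u ^+ k * v = w ^+ k * (v * u ^+ k).
        elim: k => [|k IHk]; first by rewrite !mul1g mulg1.
        rewrite !expgS -mulgA IHk !mulgA.
        rewrite (commuteX k (commute_sym wu)) -(mulgA (w ^+ k)) uv.
        by rewrite (commuteX k (commute_refl w)) !mulgA.
      apply: (mulIg (v * u ^+ p)); rewrite -uXv mul1g.
      by apply: kerZ; rewrite piX tK xp //; lia.
    split=> // [x1|r ir rj]; last by apply: c_indep; lia.
    (* If [x i j = 1], the images of the two factors commute, so the factors commute and their twist
       is 1. *)
    have := @commute_pi (T i (i + l)%N) (T (i + l)%N j).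
    rewrite /commute cE -!piM cE piM cx x1 mul1g => /(_ erefl).
    by move/(canRL (mulgK _)); rewrite mulgV.
  (* For [j < i + l + l] no [r] fits in between, so the clause on [r] is vacuous. A trivial
     generator must lift to 1; pairs out of range get the junk value 1. *)
  have [x1|x1] := pselect (x i j = 1).
    exists 1 => ij jN; split=> //; rewrite ?x1 ?expg1n // => r; lia.
  have [vij|nvij] := boolP ((i + l <= j)%N && (j < N)%N); last first.
    by exists 1 => ij jN; rewrite ij jN in nvij.
  case/andP: vij => ij jN.
  have [w w1 wp] : exists2 w, pi w = 1 & w ^+ p = T i j ^+ p.
    by apply: ker_div; rewrite piX tK xp.
  exists (T i j * w^-1) => _ _; split=> //; last by move=> r; lia.
    by rewrite piM piV tK w1 invg1 mulg1.
  rewrite expgMn ?expVgn ?wp ?mulgV //.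
  by apply: commute_sym; apply: kerZ; rewrite piV w1 invg1.
exists (fun i j => y (i, j)) => [|i j ij jN]; last by case: (yP (i, j)).
have pY i j : (i + l <= j)%N -> (j < N)%N -> pi (y (i, j)) = x i j.
  by move=> ij jN; case: (yP (i, j) ij jN).
split=> [i j ij jN|i j k m ij km jN mN jk im|i j k ij jk kN].
- by case: (yP (i, j) ij jN).
- by apply: commute_pi; rewrite !pY //; apply: xC.
have jN : (j < N)%N by lia.
have ik : (i + l <= k)%N by lia.
case: (yP (i, k) ik kN) => /= _ _ _ /(_ j ij jk) <-; move: (cE i j k).
(* The lifts [T] and [y] differ by central elements, which cancel from the relation [cE]. *)
have tz a b : (a + l <= b)%N -> (b < N)%N ->
    exists2 z, pi z = 1 & T a b = z * y (a, b).
  move=> ab bN; exists (T a b * (y (a, b))^-1); last by rewrite mulgVK.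
  by rewrite piM piV tK pY // mulgV.
have [z z1 ->] := tz i j ij jN; have [z' z'1 ->] := tz j k jk kN.
set Y := y (i, j); set Y' := y (j, k); set C := c _ _ _.
have zC u : z * u = u * z by exact: kerZ.
have z'C u : z' * u = u * z' by exact: kerZ.
rewrite !zC !z'C !mulgA -(mulgA _ z Y') zC -(mulgA _ z' Y) z'C !mulgA.
by rewrite -(mulgA _ z z') -(mulgA _ z' z) (zC z') => /mulIg.
Qed.
End Lift.

(** * Ordered products of generators, column by column *)

Section Product.
Variables (p l N : nat) (H : groupType) (y : nat -> nat -> H).
Hypothesis l_gt0 : (0 < l)%N.
Hypothesis steinberg_y : steinberg p l N y.
Implicit Types v : nat -> nat -> nat.

(** [m] truncates the column so that induction can run over its rows. *)
Definition column v k m : H :=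
  \prod_(0 <= r < m) (if (r + l <= k)%N then y r k ^+ v r k else 1).

(* The columns are multiplied in decreasing order of their index: a
   unitriangular matrix is the product of its columns in this order. *)
Fixpoint columns v k : H :=
  if k is k'.+1 then column v k' N * columns v k' else 1.

Lemma steinberg_expg_mod i j a b : (i + l <= j)%N -> (j < N)%N ->
  a = b %[mod p] -> y i j ^+ a = y i j ^+ b.
Proof.
case: steinberg_y => yp _ _ ij jN ab.
rewrite (divn_eq a p) (divn_eq b p) ab !expgnDr.
by rewrite !(mulnC _ p) !expgnA yp // !expg1n.
Qed.

Lemma commute_column i k v m : (i + l <= k)%N -> (k < N)%N ->
  commute (y i k) (column v k m).
Proof.
case: steinberg_y => _ yC _ ik kN; apply: commute_prod => r _.
case: ifP => rk; last exact: commute1.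
by apply: commuteX; apply: yC => //; lia.
Qed.

Lemma eq_column v v' k m : (k < N)%N ->
    (forall r, (r + l <= k)%N -> v' r k = v r k %[mod p]) ->
  column v' k m = column v k m.
Proof.
move=> kN vv'; apply: eq_bigr => r _; case: ifP => // rk.
by apply: steinberg_expg_mod => //; exact: vv'.
Qed.

(** All factors of a column commute, so the extra power of [y i k] moves to the front, once the
    truncation has passed row [i]. *)
Lemma column_add i a v v' k m : (i + l <= k)%N -> (k < N)%N ->
    (forall r, (r + l <= k)%N -> v' r k = v r k + (r == i) * a %[mod p]) ->
  column v' k m = (if (i < m)%N then y i k ^+ a else 1) * column v k m.
Proof.
move=> ik kN vv'; elim: m => [|m IHm]; first by rewrite /column !big_geq ?mul1g.
rewrite /column !big_nat_recr //= -!/(column _ _ _) {}IHm ltnS -mulgA.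
rewrite (leq_eqVlt i); have [mk|km] := leqP (m + l)%N k; last first.
  by rewrite !mulg1; have [im|_] := eqVneq i m; first lia.
rewrite (steinberg_expg_mod mk kN (vv' _ mk)) (eq_sym m).
have [<-|_] := eqVneq i m; last by rewrite mul0n addn0.
rewrite ltnn mul1g mul1n addnC expgnDr !mulgA; congr (_ * _).
exact/commuteX/commute_sym/commute_column.
Qed.

(** [y i j] commutes with every factor of column [k] except the power of [y j k]; passing that one
    creates [y i k ^+ v j k], which commutes with the whole column. If [k < j + l] the column has no
    factor in row [j], and [v j k = 0] makes both sides agree. *)
Lemma column_mul i j v k m : (i + l <= j)%N -> (j < k)%N -> (k < N)%N ->
    ((k < j + l)%N -> v j k = 0%N) ->
  y i j * column v k m =
    (if (j < m)%N then y i k ^+ v j k else 1) * column v k m * y i j.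
Proof.
case: steinberg_y => _ yC yM ij jk kN v0.
elim: m => [|m IHm]; first by rewrite /column !big_geq ?(mul1g, mulg1).
rewrite /column !big_nat_recr //= -!/(column _ _ _) mulgA {}IHm ltnS.
have [ne_jm|ne_jm|<-] := ltngtP j m.
- rewrite -!mulgA; do 2![congr (_ * _)].
  case: ifP => mk; last by rewrite mul1g mulg1.
  by apply: commuteX; apply: yC => //; lia.
- rewrite -!mulgA; do 2![congr (_ * _)].
  case: ifP => mk; last by rewrite mul1g mulg1.
  by apply: commuteX; apply: yC => //; lia.
have [mk|km] := leqP (j + l)%N k; last by rewrite v0 // !mulg1 !mul1g.
have ik : (i + l <= k)%N by lia.
have [cikij cikjk] : commute (y i k) (y i j) /\ commute (y i k) (y j k).
  by split; apply: yC => //; lia.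
have step a : y i j * y j k ^+ a = y i k ^+ a * (y j k ^+ a * y i j).
  elim: a => [|a IHa]; first by rewrite !mul1g mulg1.
  rewrite expgSr mulgA IHa -!mulgA yM // (mulgA (y j k ^+ a)).
  by rewrite -(commuteX _ cikjk) !mulgA -expgSr.
rewrite mul1g -mulgA step !mulgA; congr (_ * _ * _).
exact/commuteX/commute_sym/commute_column.
Qed.

(** Left multiplication by 1 + e_ij adds row [j] to row [i], which [v'] records. Pushing [y i j]
    rightwards through a column [k > j] adds [v j k] to the exponent of [y i k]. Column [j] absorbs
    [y i j] itself, and the columns below [j] do not change since row [j] vanishes there. *)
Lemma columns_mul i j v v' : (i + l <= j)%N -> (j < N)%N ->
    (forall r k, (r + l <= k)%N -> (k < N)%N ->
      v' r k = v r k + (r == i) * v j k %[mod p]) ->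
    (forall k, (k < j + l)%N -> (k < N)%N -> v j k = (k == j)) ->
  columns v' N = y i j * columns v N.
Proof.
move=> ij jN vv' vj.
suff colE k : (k <= N)%N ->
    columns v' k = (if (j < k)%N then y i j else 1) * columns v k.
  by rewrite colE // jN.
elim: k => [|k IHk] kN /=; first by rewrite mul1g.
rewrite (IHk (ltnW kN)) ltnS; have [jk|kj|<-] := ltngtP j k.
- have ik : (i + l <= k)%N by lia.
  have iN : (i < N)%N by lia.
  rewrite (@column_add i (v j k) v) // => [|r rk]; last exact: vv'.
  rewrite iN !mulgA; congr (_ * _); rewrite column_mul ?jN //.
  by move=> kj; rewrite vj //; case: eqVneq => // kj'; lia.
- rewrite !mul1g (@eq_column v) // => r rk; rewrite vv' // vj //; last by lia.
  by rewrite (ltn_eqF kj) muln0 addn0.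
rewrite mul1g mulgA; congr (_ * _).
rewrite (@column_add i 1 v) ?expg1 // => [|r rj]; last first.
  by rewrite vv' // vj ?eqxx //; lia.
by rewrite ifT //; lia.
Qed.

Lemma columns1 v : (forall r k, (r + l <= k)%N -> (k < N)%N ->
    v r k = 0%N \/ y r k = 1) -> columns v N = 1.
Proof.
move=> v0; suff colE k : (k <= N)%N -> columns v k = 1 by exact: colE.
elim: k => //= k IHk kN; rewrite (IHk (ltnW kN)) mulg1.
apply: big1 => r _; case: ifP => // rk.
by case: (v0 r k rk kN) => ->; rewrite ?expg1n.
Qed.

End Product.

(** * Descent of the splitting from a matrix group to its image *)

Section SteinbergSection.
Variables (p l N : nat) (K : finGroupType) (U : {group K}) (G E : groupType).
Variables (pi : E -> G) (phi : K -> G) (x : nat -> nat -> K).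
(* [v g r k] is the [(r, k)] entry of [g], as a natural number modulo [p]. *)
Variable v : K -> nat -> nat -> nat.
Hypothesis l_gt0 : (0 < l)%N.
Hypothesis piM : {morph pi : u v / u * v}.
Hypothesis pi_surj : forall g, exists u, pi u = g.
Hypothesis commute_pi : forall u v, commute (pi u) (pi v) -> commute u v.
Hypothesis ker_div : forall u, pi u = 1 -> exists2 w, pi w = 1 & w ^+ p = u.
Hypothesis steinberg_x : steinberg p l N x.
Hypothesis xU : forall i j, (i + l <= j)%N -> (j < N)%N -> x i j \in U.
Hypothesis U_ind : forall P : K -> Prop, P 1 ->
  (forall i j g, (i + l <= j)%N -> (j < N)%N -> g \in U -> P g ->
     P (x i j * g)) ->
  forall g, g \in U -> P g.
Hypothesis v_diag : forall g j k, g \in U -> (j < N)%N -> (k < N)%N ->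
  (k < j + l)%N -> v g j k = (k == j).
Hypothesis v1 : forall r k, (r + l <= k)%N -> (k < N)%N -> v 1 r k = 0%N.
Hypothesis vM : forall i j g r k, (i + l <= j)%N -> (j < N)%N -> g \in U ->
  (r + l <= k)%N -> (k < N)%N ->
  v (x i j * g) r k = v g r k + (r == i) * v g j k %[mod p].
Hypothesis phiM : {in U &, {morph phi : g h / g * h}}.
Hypothesis phi_surj : forall y, exists2 g, g \in U & phi g = y.
Hypothesis phi_ker : forall g, g \in U -> phi g = 1 ->
  forall i j, (i + l <= j)%N -> (j < N)%N -> v g i j = 0%N \/ phi (x i j) = 1.

(** The ordered product [s] is compatible with left multiplication by generators, hence
    multiplicative on [U]. It kills the kernel of [phi]: by [phi_ker], in each factor either the
    exponent is 0 or the generator dies in [G], and then its lift is 1. *)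
Lemma steinberg_section :
  exists2 s : G -> E, {morph s : a b / a * b} & forall a, pi (s a) = a.
Proof.
have phi1 : phi 1 = 1 by apply: (mulgI (phi 1)); rewrite -phiM // !mulg1.
have phiX g k : g \in U -> phi (g ^+ k) = phi g ^+ k.
  move=> gU; elim: k => [|k IHk]; first exact: phi1.
  by rewrite !expgS phiM ?groupX // IHk.
have [xp xC xM] := steinberg_x.
have : steinberg p l N (fun i j => phi (x i j)).
  split=> [i j ij jN|i j k m ij km jN mN jk im|i j k ij jk kN].
  - by rewrite -phiX ?xU // xp.
  - by rewrite /commute -!phiM ?xU // xC.
  have jN : (j < N)%N by lia.
  have ik : (i + l <= k)%N by lia.
  by rewrite -!phiM ?xM ?groupM ?xU.
case/(steinberg_lift l_gt0 piM pi_surj commute_pi ker_div) => y yS yP.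
pose s g := columns l N y (v g) N.
have s1 : s 1 = 1 by apply: columns1 => r k rk kN; left; apply: v1.
have sM i j g : (i + l <= j)%N -> (j < N)%N -> g \in U ->
    s (x i j * g) = y i j * s g.
  move=> ij jN gU; apply: (columns_mul l_gt0 yS) => // [r k rk kN|k kj kN].
    exact: vM.
  exact: v_diag.
have sMM g h : g \in U -> h \in U -> s (g * h) = s g * s h.
  move=> gU hU; move: g gU; apply: U_ind => //; first by rewrite s1 !mul1g.
  move=> i j g ij jN gU IHg.
  by rewrite -mulgA !sM ?groupM // IHg mulgA.
have pi1 : pi 1 = 1 by apply: (mulgI (pi 1)); rewrite -piM !mulg1.
have pis g : g \in U -> pi (s g) = phi g.
  move: g; apply: U_ind => // [|i j g ij jN gU IHg].
    by rewrite s1 pi1 phi1.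
  by rewrite sM // piM IHg phiM ?xU //; case: (yP i j ij jN) => ->.
have s_ker g : g \in U -> phi g = 1 -> s g = 1.
  move=> gU g1; apply: columns1 => r k rk kN.
  case: (phi_ker gU g1 rk kN) => [->|x1]; [by left | right].
  by case: (yP r k rk kN) => _; apply.
have s_eq g h : g \in U -> h \in U -> phi g = phi h -> s g = s h.
  move=> gU hU gh; rewrite -[g](mulgVK h) sMM ?groupM ?groupV //.
  rewrite s_ker ?mul1g //.
    by rewrite groupM ?groupV.
  apply: (mulIg (phi h)); rewrite -phiM ?groupM ?groupV //.
  by rewrite mulgVK mul1g.
(* [q] is an arbitrary set-theoretic section of [phi]; by [s_eq] the choice does not affect [s]. *)
have /choice[q qP] : forall z, exists g, g \in U /\ phi g = z.
  by move=> z; case: (phi_surj z) => g; exists g.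
have qU z : q z \in U by case: (qP z).
have phiq z : phi (q z) = z by case: (qP z).
exists (s \o q) => [z z'|z] /=; last by rewrite pis.
by rewrite -sMM //; apply: s_eq; rewrite ?groupM // phiM // !phiq.
Qed.

End SteinbergSection.

End Steinberg.

(** * Elementary matrices: relations and generation of [UTl] *)

Section Elementary.
Import GroupScope.
Local Open Scope nat_scope.
Local Open Scope group_scope.
Variables (n p : nat).
Hypothesis p_prime : prime p.
Import GRing.Theory.
Local Open Scope ring_scope.
Local Notation N := n.-1.+1.
(* Going through [FinGroup.sort] fixes the group structure that unification
   sees; on the bare type [{'GL_n(p)}] it has to unfold the matrix product. *)
Local Notation GL := (FinGroup.sort {'GL_n(p)}).

Lemma mulrC_1D (R : pzRingType) (A B : R) : A * B = 0 -> B * A = 0 ->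
  (1 + A) * (1 + B) = (1 + B) * (1 + A).
Proof.
move=> AB BA; rewrite !(mulrDl, mulrDr) AB BA !(mul1r, mulr1) !addr0.
exact: addrAC.
Qed.

Lemma mulr_1D_twist (R : pzRingType) (A B C : R) :
    A * B = C -> B * A = 0 -> C * A = 0 -> C * B = 0 ->
  (1 + A) * (1 + B) = (1 + C) * ((1 + B) * (1 + A)).
Proof.
move=> AB BA CA CB.
have -> : (1 + B) * (1 + A) = 1 + A + B.
  by rewrite mulrDl mul1r mulrDr BA mulr1 addr0.
rewrite !(mulrDl, mulrDr) !(mul1r, mulr1) AB CA CB !addr0 addrA.
by congr (_ + _); exact: addrAC.
Qed.

(** The default of [insubd] is not reached when [i < j < N]: the matrix then has inverse 1 - e_ij.
    Indices are natural numbers to match [steinberg]. *)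
Definition elementary (i j : nat) : GL :=
  insubd (1%g : {'GL_n(p)}) (1 + delta_mx (inord i) (inord j) : 'M['F_p]_N).

Definition entry (g : GL) (i j : nat) : 'F_p :=
  GLval g (inord i) (inord j).

Lemma GLval_inj : injective (GLval : GL -> 'M['F_p]_N).
Proof. exact: val_inj. Qed.

Lemma GLvalM (u v : GL) : GLval (u * v)%g = GLval u *m GLval v.
Proof. by []. Qed.

Lemma inord_neq i j : (i < N)%N -> (j < N)%N -> i <> j ->
  (inord i : 'I_N) != inord j.
Proof.
move=> iN jN; apply: contra_notN => /eqP/(congr1 (@nat_of_ord _)).
by rewrite !inordK.
Qed.

Lemma elementaryE i j : (i < j)%N -> (j < N)%N ->
  GLval (elementary i j) = 1 + delta_mx (inord i) (inord j).
Proof.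
move=> ij jN; rewrite -[LHS]/(val _) val_insubd; case: ifP => // /negP[].
have E0 : delta_mx (inord i) (inord j) * delta_mx (inord i) (inord j) = 0
    :> 'M['F_p]_N.
  by apply: mul_delta_mx_0; apply: inord_neq; lia.
apply/unitrP; exists (1 - delta_mx (inord i) (inord j)).
split; first by rewrite mulrBl mul1r mulrDr mulr1 E0 addr0 addrK.
by rewrite mulrBr mulr1 mulrDl mul1r E0 addr0 addrK.
Qed.

(** Each factor adds row [j] to row [i]. Row [j] itself never changes, as [i] differs from [j], so
    [a] factors add [a] times row [j]. *)
Lemma entry_elementaryX_mul i j a (g : GL) (r c : 'I_N) :
    (i < j)%N -> (j < N)%N ->
  GLval (elementary i j ^+ a * g)%g r c =
    GLval g r c + ((r == inord i) * a)%:R * GLval g (inord j) c.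
Proof.
move=> ij jN; elim: a => [|a IHa]; first by rewrite mul1g muln0 mul0r addr0.
have Ec (h : GL) r' : GLval (elementary i j * h)%g r' c =
    GLval h r' c + (r' == inord i)%:R * GLval h (inord j) c.
  rewrite GLvalM elementaryE // mulmxDl mul1mx !mxE; congr (_ + _).
  rewrite (bigD1 (inord j)) //= big1 => [|k /negPf kj]; rewrite !mxE.
    by rewrite eqxx andbT addr0.
  by rewrite kj andbF mul0r.
rewrite expgS -mulgA Ec IHa.
have -> : GLval (elementary i j ^+ a * g)%g (inord j) c = GLval g (inord j) c.
  elim: (a) => [|b IHb]; first by rewrite mul1g.
  rewrite expgS -mulgA Ec IHb (negPf (inord_neq _ _ _)) ?mul0r ?addr0 //; lia.
by rewrite -addrA -mulrDl -natrD mulnS addnC.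
Qed.

Lemma elementary_UTl l i j : (0 < l)%N -> (i + l <= j)%N -> (j < N)%N ->
  elementary i j \in UTl n p l.
Proof.
move=> l0 ij jN; apply/in_UTl => r c rc; rewrite elementaryE ?mxE; try lia.
have [r_i|_] := eqVneq r (inord i); last by rewrite addr0.
have [c_j|_] := eqVneq c (inord j); last by rewrite addr0.
by move: rc; rewrite r_i c_j !inordK; lia.
Qed.

Lemma delta_mx_mul0 (i j k m : nat) : (j < N)%N -> (k < N)%N -> j <> k ->
  delta_mx (inord i) (inord j) * delta_mx (inord k) (inord m) = 0
    :> 'M['F_p]_N.
Proof. by move=> jN kN jk; apply: mul_delta_mx_0; apply: inord_neq. Qed.

Lemma GLval_eqM (u v : GL) (a b : 'M['F_p]_N) :
  GLval u = a -> GLval v = b -> GLval (u * v)%g = a * b.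
Proof. by move=> <- <-; exact: GLvalM. Qed.

Lemma commute_elementary i j k m : (i < j)%N -> (k < m)%N ->
    (j < N)%N -> (m < N)%N -> j <> k -> i <> m ->
  (elementary i j * elementary k m = elementary k m * elementary i j)%g.
Proof.
move=> ij km jN mN jk im; apply: GLval_inj.
apply: etrans (GLval_eqM (elementaryE ij jN) (elementaryE km mN)) _.
apply: etrans _ (esym (GLval_eqM (elementaryE km mN) (elementaryE ij jN))).
by apply: mulrC_1D; apply: delta_mx_mul0; lia.
Qed.

Lemma elementary_twist i j k : (i < j)%N -> (j < k)%N -> (k < N)%N ->
  (elementary i j * elementary j k =
   elementary i k * (elementary j k * elementary i j))%g.
Proof.
move=> ij jk kN; have jN := ltn_trans jk kN; have ik := ltn_trans ij jk.
apply: GLval_inj; have Eji := GLval_eqM (elementaryE jk kN) (elementaryE ij jN).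
apply: etrans (GLval_eqM (elementaryE ij jN) (elementaryE jk kN)) _.
apply: etrans _ (esym (GLval_eqM (elementaryE ik kN) Eji)).
by apply: mulr_1D_twist; [apply: mul_delta_mx|..]; apply: delta_mx_mul0; lia.
Qed.

Lemma elementary_steinberg l : (0 < l)%N -> steinberg p l N elementary.
Proof.
move=> l0; split=> [i j ij jN|i j k m ij km jN mN jk im|i j k ij jk kN].
- apply: GLval_inj; apply/matrixP => r c.
  rewrite -[(_ ^+ _)%g]mulg1 entry_elementaryX_mul //; last lia.
  by rewrite natrM pchar_Fp_0 ?mulr0 ?mul0r ?addr0.
- by apply: commute_elementary => //; lia.
by apply: elementary_twist => //; lia.
Qed.

(** Gaussian elimination as an induction principle; the measure is the number of nonzero
    off-diagonal entries. *)
Lemma UTl_ind l (P : GL -> Prop) : (0 < l)%N -> P (1%g : GL) ->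
    (forall i j g, (i + l <= j)%N -> (j < N)%N -> g \in UTl n p l -> P g ->
       P (elementary i j * g)%g) ->
  forall g, g \in UTl n p l -> P g.
Proof.
move=> l0 P1 PM.
have PX i j a g : (i + l <= j)%N -> (j < N)%N -> g \in UTl n p l -> P g ->
    P (elementary i j ^+ a * g)%g.
  move=> ij jN gU Pg; elim: a => [|a IHa]; first by rewrite mul1g.
  rewrite expgS -mulgA; apply: PM => //.
  exact: (groupM (groupX _ (elementary_UTl l0 ij jN)) gU).
pose S (g : GL) :=
  [set rc : 'I_N * 'I_N | (rc.1 != rc.2) && (GLval g rc.1 rc.2 != 0)]%SET.
move=> g; have [m] := ubnP #|S g|; elim: m g => // m IHm g.
rewrite ltnS => Sm gU.
have /in_UTl gE := gU.
have [S0|[rc0 rc0S]] := set_0Vmem (S g).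
  have -> : g = (1%g : GL); last exact: P1.
  apply: GLval_inj; apply/matrixP => r c; rewrite mxE.
  have [<-|ne_rc] := eqVneq r c; first by rewrite gE ?leqnn // eqxx.
  have := finset.in_set0 (r, c); rewrite -S0 inE /= ne_rc /=.
  by move/negbT; rewrite negbK => /eqP.
(* In the last row [i] of [g] with a nonzero off-diagonal entry, such an entry
   [(i, j)] can be cleared alone, as row [j] of [g] is trivial. *)
case: (@arg_maxnP _ rc0 (mem (S g)) (fun rc => rc.1) rc0S) => -[i j] /=.
rewrite inE /= => /andP[ne_ij gij] imax.
have ij : (i + l <= j)%N.
  rewrite leqNgt; apply: contra gij => h.
  by rewrite gE ?h ?orbT // (negPf ne_ij).
have jE (c : 'I_N) : GLval g j c = (j == c)%:R.
  have [<-|ne_jc] := eqVneq j c; first by rewrite gE ?leqnn // eqxx.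
  apply/eqP; apply: contraT => gjc; have := imax (j, c).
  by rewrite inE /= ne_jc gjc => /(_ isT); lia.
pose x := elementary i j; pose a : 'F_p := GLval g i j.
have xp : (x ^+ p = 1)%g.
  by case: (elementary_steinberg l0) => -> //; exact: ltn_ord.
(* The exponent [p - a] stands for -a, because [x ^+ p = 1]. *)
pose g' := (x ^+ (p - a) * g)%g.
have xXU b : (x ^+ b)%g \in UTl n p l.
  by apply: groupX; apply: elementary_UTl.
have g'U : g' \in UTl n p l := groupM (xXU _) gU.
have ap : (a <= p)%N.
  by rewrite ltnW // -[X in (_ < X)%N](Fp_cast p_prime) ltn_ord.
have -> : g = (x ^+ a * g')%g.
  by rewrite /g' mulgA -expgnDr subnKC // xp mul1g.
apply: (PX _ _ _ _ ij (ltn_ord j) g'U); apply: IHm g'U.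
have g'E r c : GLval g' r c = if (r == i) && (c == j) then 0 else GLval g r c.
  rewrite entry_elementaryX_mul //; last lia.
  rewrite !inord_val jE natrM natrB // pchar_Fp_0 // sub0r natr_Zp.
  have [->|_] := eqVneq r i; last by rewrite !mul0r addr0.
  rewrite mul1r (eq_sym j).
  have [->|_] := eqVneq c j; last by rewrite mulr0 addr0.
  by rewrite mulr1 subrr.
apply: leq_trans (proper_card _) Sm; apply/properP; split.
  apply/fintype.subsetP => -[r c]; rewrite !inE /= g'E.
  by case: ifP => // _; rewrite eqxx andbF.
exists (i, j); first by rewrite inE /= ne_ij gij.
by rewrite inE /= g'E !eqxx andbF.
Qed.

End Elementary.

(** * The central extension attached to a 2-cocycle *)

Section Extension.
Import GRing.Theory.
Local Open Scope ring_scope.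
Variables (gT : finGroupType) (M : zmodType).

(* The cocycle is a phantom argument, on which the group law depends. *)
Definition extension (f : cocycle2 gT M) : Type := (gT * M)%type.

HB.instance Definition _ f := Choice.on (extension f).

Variable f : cocycle2 gT M.
Local Notation E := (extension f).
Implicit Types u v w : E.

Definition ext_mul u v : E := ((u.1 * v.1)%g, u.2 + v.2 + f (u.1, v.1)).
(** The cocycle is not assumed normalized, whence the corrections by [f (1, 1)] in the unit and the
    inverse. *)
Definition ext_one : E := (1%g, - f (1%g, 1%g)).
Definition ext_inv u : E :=
  (u.1^-1%g, - (u.2 + f (u.1, u.1^-1%g) + f (1%g, 1%g))).

Lemma cocycle2E x y z : f (y, z) + f (x, y * z)%g = f (x * y, z)%g + f (x, y).
Proof.
have /eqP := is_cocycle2P _ (cocycle2_valP f) x y z.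
by rewrite subr_eq0 addrAC subr_eq => /eqP ->; exact: addrC.
Qed.

Lemma cocycle2_1l x : f (1%g, x) = f (1%g, 1%g).
Proof. by have := cocycle2E 1%g 1%g x; rewrite !mul1g => /addrI. Qed.

Lemma cocycle2_1r x : f (x, 1%g) = f (1%g, 1%g).
Proof.
by have := cocycle2E x 1%g 1%g; rewrite !mulg1 => /addIr.
Qed.

Lemma cocycle2_V x : f (x^-1%g, x) = f (x, x^-1%g).
Proof.
have := cocycle2E x x^-1%g x.
rewrite mulgV mulVg (cocycle2_1l x) (cocycle2_1r x).
by rewrite [RHS]addrC => /addIr.
Qed.

Lemma ext_mulA : associative ext_mul.
Proof.
move=> u v w; congr pair; first exact: mulgA.
rewrite /= -!addrA cocycle2E; do 2!congr (_ + _).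
by rewrite [RHS]addrC -addrA.
Qed.

Lemma ext_mul1 : left_id ext_one ext_mul.
Proof.
case=> x a; congr pair; rewrite /ext_one /= ?mul1g //.
by rewrite (cocycle2_1l x) addrAC addNr add0r.
Qed.

Lemma ext_mulr1 : right_id ext_one ext_mul.
Proof.
case=> x a; congr pair; rewrite /ext_one /= ?mulg1 //.
by rewrite (cocycle2_1r x) addrNK.
Qed.

Lemma ext_mulV : left_inverse ext_one ext_inv ext_mul.
Proof.
case=> x a; congr pair; rewrite /ext_one /ext_inv /= ?mulVg // cocycle2_V.
by rewrite -addrA opprD addrAC addNr add0r.
Qed.

Lemma ext_mulrV : right_inverse ext_one ext_inv ext_mul.
Proof.
case=> x a; congr pair; rewrite /ext_one /ext_inv /= ?mulgV //.
by rewrite addrAC opprD addrA subrr add0r.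
Qed.

HB.instance Definition _ := isGroup.Build E
  ext_mulA ext_mul1 ext_mulr1 ext_mulV ext_mulrV.

Lemma fstM : {morph (fst : E -> gT) : u v / (u * v)%g}.
Proof. by []. Qed.

(** Shifting by [f (1, 1)] identifies [M] with the kernel of the projection; this transfers
    divisibility from [M] to that kernel. *)
Lemma extensionX_eq1 (a : M) k :
  (((1%g, (a - f (1%g, 1%g))%R) : E) ^+ k)%g =
    (1%g, a *+ k - f (1%g, 1%g)) :> E.
Proof.
elim: k => [|k IHk]; first by rewrite mulr0n add0r.
rewrite expgS IHk; congr pair => /=; first exact: mul1g.
by rewrite /= addrA addrNK mulrS addrAC.
Qed.

(** Compare second components in [s (x * y) = s x * s y]. The minus sign in the witness matches the
    convention [h y - h (x * y) + h x]. *)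
Lemma coboundary_of_section (s : gT -> E) :
    {morph s : x y / (x * y)%g} -> (forall x, (s x).1 = x) ->
  f \in is_coboundary2.
Proof.
move=> sM s1; apply/asboolP; exists (fun x => - (s x).2) => x y.
rewrite sM /= !s1 opprK; set a := (s x).2; set b := (s y).2.
by rewrite -(addrA a) addrCA addKr addrAC subrr add0r.
Qed.

End Extension.

(** * Symmetry of Bogomolov classes on commuting pairs; divisibility of Q/Z *)

Section Bogomolov.
Import GRing.Theory GroupScope.
Local Open Scope nat_scope.
Local Open Scope quotient_scope.
Local Open Scope group_scope.

(** An abelian group with two generators has rank at most 2, so the decomposition from
    [abelian_structure] has at most two cyclic factors. *)
Lemma bicyclic_gen2 (gT : finGroupType) (x y : gT) : commute x y ->
  bicyclic <<finset.setU [set x] [set y]>>%G.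
Proof.
move=> cxy; set G := <<_>>%G.
have cGG : abelian G.
  rewrite abelian_gen; apply/centsP => a /finset.setUP[]/finset.set1P-> b.
    by case/finset.setUP=> /finset.set1P->.
  by case/finset.setUP=> /finset.set1P-> //; apply: commute_sym.
have [b defG sz_b] := abelian_structure cGG.
have: (size b <= 2)%N.
  rewrite -(size_map order) sz_b size_abelian_type // -grank_abelian //.
  by apply: leq_trans (grank_min _) _; rewrite cards2; case: (x != y).
case: b defG {sz_b} => [|a [|b [|]]] //; rewrite ?big_nil ?big_cons ?dprodg1.
- by move=> G1 _; left; rewrite -G1 cyclic1.
- by move=> Ga _; left; rewrite -Ga big_nil dprodg1 cycle_cyclic.
rewrite big_nil dprodg1 => Gab _; right.
by exists <[a]>%G, <[b]>%G; split; rewrite ?cycle_cyclic.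
Qed.

(** The class restricts to a coboundary on the bicyclic group generated by [x] and [y], and
    coboundaries are symmetric on commuting pairs. *)
Lemma bogomolov_cocycle2_sym (gT : finGroupType) (c : H2 gT QZ) x y :
  bogomolov_multiplier gT c -> commute x y ->
  (generic_quotient.repr c) (x, y) = (generic_quotient.repr c) (y, x).
Proof.
move=> cB cxy; pose A := <<finset.setU [set x] [set y]>>%G.
have := cB A (bicyclic_gen2 cxy); rewrite /= /res2 => /eqP.
rewrite H2_pi_eq0 => /asboolP[h hE].
have xA : x \in A by rewrite mem_gen // !inE eqxx.
have yA : y \in A by rewrite mem_gen // !inE eqxx orbT.
have := hE (subg A x) (subg A y); have := hE (subg A y) (subg A x).
rewrite /= !ffunE /= !subgK // => -> ->.
have -> : subg A x * subg A y = subg A y * subg A x.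
  by apply: val_inj; rewrite /= !subgK.
by rewrite addrC addrA addrAC.
Qed.

Lemma QZ_divisible (q : QZ) k : (0 < k)%N -> exists w : QZ, (w *+ k)%R = q.
Proof.
move=> k0; exists (\pi_(QZ) (generic_quotient.repr q / k%:R)%R).
rewrite -raddfMn -(mulr_natr (generic_quotient.repr q / _)%R) divfK.
  exact: reprK.
by rewrite Num.Theory.pnatr_eq0 -lt0n.
Qed.

End Bogomolov.

(** * Vanishing for suitable images of [UTl] *)

Section Images.
Import GRing.Theory GroupScope.
Local Open Scope nat_scope.
Local Open Scope quotient_scope.
Local Open Scope group_scope.

Lemma bogomolov_multiplier_eq0 (gT : finGroupType) :
    (forall f : cocycle2 gT QZ,
       (forall x y, commute x y -> f (x, y) = f (y, x)) ->
       f \in is_coboundary2) ->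
  bogomolov_multiplier gT = [set 0%R]%classic.
Proof.
move=> symB; apply/seteqP; split=> [c cB|_ -> A _] /=.
  apply/eqP; rewrite -[c]reprK H2_pi_eq0; apply: symB => x y.
  exact: bogomolov_cocycle2_sym cB.
rewrite -(raddf0 (\pi_(H2 gT QZ))) res2_pi; apply/eqP; rewrite H2_pi_eq0.
apply/asboolP; exists (fun=> 0%R) => x y.
by rewrite subrr addr0 /= !ffunE.
Qed.

Section Image.
Variables (n p l : nat) (gT : finGroupType).
Local Notation N := n.-1.+1.
Variable phi : FinGroup.sort {'GL_n(p)} -> gT.
Hypothesis p_prime : prime p.
Hypothesis l_gt0 : (0 < l)%N.
Hypothesis phiM : {in UTl n p l &, {morph phi : g h / g * h}}.
Hypothesis phi_surj : forall y, exists2 g, g \in UTl n p l & phi g = y.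
Hypothesis phi_ker : forall g, g \in UTl n p l -> phi g = 1 ->
  forall i j, (i + l <= j)%N -> (j < N)%N ->
  entry g i j = 0%R \/ phi (elementary n p i j) = 1.

(** This covers the three families at once: [phi] is an isomorphism for [UT] and [UTl], and for the
    quotients it is the coset map on [UTl n p 1] followed by an isomorphism. *)
Lemma UTl_image_bogomolov : bogomolov_multiplier gT = [set 0%R]%classic.
Proof.
apply: bogomolov_multiplier_eq0 => f fC.
pose E := extension f; pose pi : E -> gT := fst.
have pi_surj g : exists u : E, pi u = g by exists (g, 0%R).
have commute_pi (u v : E) : commute (pi u) (pi v) -> commute u v.
  by move=> cuv; congr pair; [exact: cuv | rewrite (fC _ _ cuv) (addrC u.2)].
have ker_div (u : E) : pi u = 1 -> exists2 w : E, pi w = 1 & w ^+ p = u.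
  case: u => x a /= ->.
  (* Adding [f (1, 1)] turns the kernel element into the element of [QZ] that it represents, which
     can be divided by [p]. *)
  have [b bE] := QZ_divisible (a + f (1%g, 1%g))%R (prime_gt0 p_prime).
  exists (1, (b - f (1%g, 1%g))%R) => //.
  by rewrite extensionX_eq1 bE addrK.
pose v (g : FinGroup.sort {'GL_n(p)}) r k : nat := entry g r k.
have v_diag g j k : g \in UTl n p l -> (j < N)%N -> (k < N)%N ->
    (k < j + l)%N -> v g j k = (k == j).
  move=> /in_UTl gU jN kN kj; rewrite /v /entry gU ?inordK ?kj ?orbT //.
  by rewrite -val_eqE /= !inordK // eq_sym; case: eqP.
have v1 r k : (r + l <= k)%N -> (k < N)%N -> v 1 r k = 0%N.
  move=> rk kN; rewrite /v /entry GL_1E mxE (negPf (inord_neq _ _ _)) //; lia.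
have vM i j g r k : (i + l <= j)%N -> (j < N)%N -> g \in UTl n p l ->
    (r + l <= k)%N -> (k < N)%N ->
    (v (elementary n p i j * g)%g r k =
       v g r k + (r == i) * v g j k %[mod p])%N.
  move=> ij jN gU rk kN; rewrite /v /entry -[elementary n p i j]expg1.
  rewrite entry_elementaryX_mul //; last lia.
  rewrite muln1 (_ : (inord r == inord i :> 'I_N) = (r == i)); last first.
    by apply/eqP/eqP => [/(congr1 (@nat_of_ord _))|-> //]; rewrite !inordK; lia.
  (* Writing the entries through their natural representatives turns a sum in ['F_p] into a sum of
     naturals modulo [p]. *)
  rewrite -[in LHS](natr_Zp (GLval g (inord r) _)).
  rewrite -[in LHS](natr_Zp (GLval g (inord j) _)).
  by rewrite -natrM -natrD val_Fp_nat // modn_mod.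
have v_ker g : g \in UTl n p l -> phi g = 1 -> forall i j, (i + l <= j)%N ->
    (j < N)%N -> v g i j = 0%N \/ phi (elementary n p i j) = 1.
  move=> gU g1 i j ij jN; case: (phi_ker gU g1 ij jN) => [e0|]; last by right.
  by left; rewrite /v e0.
have [s sM s1] := steinberg_section l_gt0 (@fstM _ _ f) pi_surj commute_pi
  ker_div (elementary_steinberg n p_prime l_gt0)
  (fun i j => elementary_UTl p_prime l_gt0)
  (fun P => @UTl_ind n p p_prime l P l_gt0) v_diag v1 vM phiM phi_surj v_ker.
exact: coboundary_of_section sM s1.
Qed.
End Image.
End Images.

(** * The lower central series of the unitriangular group *)

Section LowerCentral.

(** The inverses come from the convention [[~ u, v] = u^-1 * v^-1 * u * v]. *)
Lemma twist_commg (G : groupType) (a b c : G) :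
  (a * b = c * (b * a) -> c = [~ a^-1, b^-1])%g.
Proof. by rewrite commgCV => /mulIg. Qed.

Import GRing.Theory.
Local Open Scope ring_scope.

Lemma mulrB_1B (R : pzRingType) (a b : R) :
  a * b - b * a = (a - 1) * (b - 1) - (b - 1) * (a - 1).
Proof.
have E (x y : R) : (x - 1) * (y - 1) = x * y - (x + y - 1).
  by rewrite mulrBl mulrBr mul1r mulr1 -[X in _ = _ - X]addrA (opprD x) addrA.
by rewrite !E (addrC b a) (opprB (b * a)) addrA subrK.
Qed.

Section Band.
Variables (R : pzRingType) (m : nat).
Implicit Types A B : 'M[R]_m.

Definition band d A := forall i j : 'I_m, (j < i + d)%N -> A i j = 0.

Lemma bandM a b A B : band a A -> band b B -> band (a + b) (A *m B).
Proof.
move=> bA bB i j ij; rewrite mxE big1 // => r _.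
have [ri|ir] := ltnP r (i + a); first by rewrite bA ?mul0r.
by rewrite bB ?mulr0 //; lia.
Qed.

Lemma bandB a A B : band a A -> band a B -> band a (A - B).
Proof. by move=> bA bB i j ij; rewrite !mxE bA ?bB ?subr0. Qed.
End Band.

Variables (n p : nat).
Hypothesis p_prime : prime p.
Local Notation N := n.-1.+1.
Local Notation GL := (FinGroup.sort {'GL_n(p)}).

Lemma UTl_band l (g : GL) : (0 < l)%N ->
  (g \in UTl n p l) <-> band l (GLval g - 1).
Proof.
move=> l0; split=> [/in_UTl gU i j ij|gB].
  by rewrite !mxE gU ?ij ?orbT // subrr.
apply/in_UTl => i j ij; apply/eqP; rewrite -subr_eq0; apply/eqP.
have := gB i j; rewrite !mxE; apply; lia.
Qed.

Lemma UT_band0 (g : GL) : g \in UTl n p 1 -> band 0 (GLval g).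
Proof.
by move=> /in_UTl gU i j ij; rewrite gU; [case: eqP ij => // ->; lia | lia].
Qed.

(** With [k = h * g], one has [[~ g, h] - 1 = k^-1 * (g * h - h * g)]. By [mulrB_1B] the difference
    is also the ring commutator of [g - 1] and [h - 1], of bands [l] and 1, so it has band [l.+1];
    the upper triangular [k^-1] preserves this. *)
Lemma commg_UTl l (g h : GL) : (0 < l)%N -> g \in UTl n p l ->
  h \in UTl n p 1 -> [~ g, h]%g \in UTl n p l.+1.
Proof.
move=> l0 gU hU; apply/UTl_band => //.
have gU1 : g \in UTl n p 1.
  apply/UTl_band => // i j ij; apply: (proj1 (UTl_band _ l0) gU); lia.
pose k := (h * g)%g; set w := [~ g, h]%g.
have wE : GLval w = GLval k^-1%g * (GLval g * GLval h).
  have -> : w = (k^-1 * (g * h))%g by rewrite (commgC g h) mulKg.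
  exact: GLval_eqM (GLval_eqM erefl erefl).
have oneE : 1 = GLval k^-1%g * (GLval h * GLval g).
  have := GLval_eqM (erefl (GLval k^-1%g))
    (GLval_eqM (erefl (GLval h)) (erefl (GLval g))).
  by rewrite mulVg => <-.
have -> : GLval w - 1 =
    GLval k^-1%g * (GLval g * GLval h - GLval h * GLval g).
  by rewrite wE [X in _ - X = _]oneE -mulrBr.
rewrite mulrB_1B -[l.+1]add0n; apply: bandM.
  by apply: UT_band0; rewrite groupV groupM.
apply: bandB; [rewrite -[l.+1]addn1 | rewrite -[l.+1]add1n]; apply: bandM.
all: by apply/UTl_band.
Qed.

Lemma lcn_UT_sub l : (0 < l)%N -> 'L_l(UT n p)%g \subset UTl n p l.
Proof.
case: l => // l _; elim: l => [|l IHl]; first by rewrite lcn1 UTl1.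
rewrite lcnSn gen_subG; apply/fintype.subsetP => _ /imset2P[g h gL hU ->].
apply: commg_UTl => //; last by rewrite UTl1.
exact: (fintype.subsetP IHl).
Qed.

(** Induction on [l]: 1 + e_ij is a commutator of the inverses of its neighbours with indices (i,
    j-1) and (j-1, j). Together with [lcn_UT_sub] this gives the dichotomy [phi_ker] for the
    quotients. *)
Lemma elementary_lcn l i j : (0 < l)%N -> (i + l <= j)%N -> (j < N)%N ->
  elementary n p i j \in 'L_l(UT n p)%g.
Proof.
case: l => // l _; elim: l i j => [|l IHl] i j ij jN.
  by rewrite lcn1 -UTl1; apply: elementary_UTl.
have [j0 jE] : exists j0, j = j0.+1 by exists j.-1; lia.
rewrite jE in ij jN *.
have j0N : (j0 < N)%N by lia.
have ij0 : (i + l.+1 <= j0)%N by lia.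
have -> : elementary n p i j0.+1 =
    [~ (elementary n p i j0)^-1, (elementary n p j0 j0.+1)^-1]%g.
  by apply/twist_commg/elementary_twist; lia.
rewrite lcnSn; apply: mem_commg; rewrite groupV; first exact: IHl.
by rewrite /= -UTl1; apply: elementary_UTl => //; lia.
Qed.
End LowerCentral.

(** * Application to the three families *)

Section Families.
Local Open Scope group_scope.
Variables (n p : nat) (gT : finGroupType).
Hypothesis p_prime : prime p.

Lemma isog_UTl_bogomolov l : (0 < l)%N -> [set: gT] \isog UTl n p l ->
  bogomolov_multiplier gT = [set 0%R]%classic.
Proof.
move=> l0; rewrite isog_sym => /isogP[f injf fU].
apply: (@UTl_image_bogomolov n p l gT f) => // [g h gU hU|y|g gU g1 i j ij jN].
- exact: morphM.
- have : y \in f @* UTl n p l by rewrite fU inE.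
  by case/morphimP => g _ gU ->; exists g.
left; have -> : g = 1.
  by apply/eqP; rewrite -(morph_injm_eq1 injf gU) g1.
rewrite /entry GL_1E mxE (negPf (inord_neq _ _ _)) //; lia.
Qed.

Lemma isog_UT_quotient_bogomolov l : (0 < l)%N ->
    [set: gT] \isog UT n p / 'L_l(UT n p) ->
  bogomolov_multiplier gT = [set 0%R]%classic.
Proof.
move=> l0; rewrite isog_sym => /isogP[f injf fU].
have nL : {subset UTl n p 1 <= 'N('L_l(UT n p))}.
  by apply/fintype.subsetP; rewrite UTl1 lcn_norm.
have mem_coset g : g \in UTl n p 1 ->
    coset 'L_l(UT n p) g \in UT n p / 'L_l(UT n p).
  by move=> gU; apply: mem_quotient; rewrite /= -UTl1.
apply: (@UTl_image_bogomolov n p 1 gT (f \o coset 'L_l(UT n p)))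
  => // [g h gU hU|y|g gU g1 i j ij jN] /=.
- by rewrite morphM ?nL //= morphM // mem_coset.
- have : y \in f @* (UT n p / 'L_l(UT n p)) by rewrite fU inE.
  case/morphimP => _ _ /morphimP[g _ gU ->] ->.
  by exists g; rewrite // UTl1.
have gL : g \in 'L_l(UT n p).
  apply: coset_idr; first exact: nL.
  by apply/eqP; rewrite -(morph_injm_eq1 injf) ?mem_coset //; apply/eqP.
(* Generators at distance at least [l] from the diagonal die in the quotient; the entries closer to
   it vanish because ['L_l(UT n p)] lies in [UTl n p l]. *)
have [ilj|jil] := leqP (i + l) j; [right | left].
  rewrite /= coset_id ?morph1 //; exact: elementary_lcn.
have /in_UTl gE := fintype.subsetP (lcn_UT_sub n p_prime l0) _ gL.
rewrite /entry gE ?inordK ?jil ?orbT //; try lia.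
by rewrite (negPf (inord_neq _ _ _)) //; lia.
Qed.

End Families.

Theorem theorem3p1 (p n : nat) (gT : finGroupType)
    (hp : prime p) (hn : (2 <= n)%N)
    (hG : ([set: gT]%SET \isog UT n p)%g \/
          exists l : nat, (1 <= l <= n - 2)%N /\
            (([set: gT]%SET \isog UTl n p l)%g \/
             ([set: gT]%SET \isog UT n p / 'L_l(UT n p))%g)) :
  bogomolov_multiplier gT = [set 0%R]%classic.
Proof.
case: hG => [|[l [/andP[l_gt0 _] [|]]]].
- by rewrite -UTl1; apply: isog_UTl_bogomolov.
- exact: isog_UTl_bogomolov.
exact: isog_UT_quotient_bogomolov.
Qed.
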